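(* Let $I = I(\mathcal{C})$ be the edge ideal of a clutter $\mathcal{C}$ with vertex set $\{t_1,\dots,t_s\}$, and let $\mathfrak{p} \in \mathrm{Ass}(I)$ correspond to a maximal stable set $A \in \mathcal{F}_{\mathcal{C}}$, in the sense that $\mathfrak{p} = \langle N_{\mathcal{C}}(A)\rangle$. Then $t_A=\prod_{t_i\in A}t_i$ is the base of a monomial $v$ with $\mathfrak{p} = (I : v)$; that is, there is a monomial $v$ such that $\mathrm{base}(v)=t_A$ and $\mathfrak{p}=(I:v)$.
   Context: $S = K[t_1, \dots ,t_s]$ is the polynomial ring over a field $K$. A clutter $\mathcal{C}$ with vertex set $V(\mathcal{C}) = \{t_1, \dots,t_s\}$ is a family of subsets of $V(\mathcal{C})$, called edges, none of which is included in another. The edge ideal $I(\mathcal{C})$ is the ideal of $S$ generated by all squarefree monomials $t_e = \prod_{t_i \in e} t_i$ with $e$ an edge of $\mathcal{C}$. A subset $A\subseteq V(\mathcal{C})$ is stable if it contains no edge of $\mathcal{C}$; $\mathcal{F}_{\mathcal{C}}$ is the family of all maximal stable sets of $\mathcal{C}$. The neighbour set $N_{\mathcal{C}}(A)$ of a stable set $A$ is the set of all vertices $t_i$ such that $\{t_i\} \cup A$ contains an edge of $\mathcal{C}$. For a monomial $u$, $\mathrm{base}(u)$ is the product of all variables dividing $u$ (each taken once). $\mathrm{Ass}(I)$ is the set of associated primes of $S/I$, and $(I:v)=\{f\in S: fv\in I\}$. *)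

(* Defs.v *)
From HB Require Import structures.
From mathcomp Require Import all_boot all_algebra.
From mathcomp Require Export mpoly.

Set Implicit Arguments.
Unset Strict Implicit.
Unset Printing Implicit Defensive.

Import GRing.Theory.
Local Open Scope ring_scope.

(* Ideals are Prop-valued predicates, compared extensionally: the ideals of
   ring_quotient.v are boolean, hence restricted to decidable membership. *)
Section Ideals.
Variable R : comNzRingType.
Implicit Types (I P G : R -> Prop).

Definition eq_ideal I P : Prop := forall f, I f <-> P f.

Definition ideal I : Prop :=
  [/\ I 0,
      forall f g, I f -> I g -> I (f + g)
    & forall f g, I g -> I (f * g)].

Definition prime_ideal P : Prop :=
  [/\ ideal P, ~ P 1 & forall f g, P (f * g) -> P f \/ P g].

Definition ideal_gen G : R -> Prop := fun f =>
  exists n (c g : 'I_n -> R),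
    (forall i, G (g i)) /\ f = \sum_(i < n) c i * g i.

Definition colon I (v : R) : R -> Prop := fun f => I (f * v).

(* The associated primes of the module R / I: the annihilator of the class of
   v in R / I is (I : v). *)
Definition Ass I P : Prop :=
  prime_ideal P /\ exists v, eq_ideal P (colon I v).

End Ideals.

Section Clutters.
Variable s : nat.
Implicit Types (C : {set {set 'I_s}}) (A : {set 'I_s}).

(* The vertices t_1, ..., t_s are the elements of 'I_s; C is the set of edges. *)
Definition clutter C : Prop :=
  forall e e', e \in C -> e' \in C -> e \subset e' -> e = e'.

Definition stable C A : bool := [forall e in C, ~~ (e \subset A)].

Definition maxstable C : {set {set 'I_s}} := [set A | maxset (stable C) A].

Definition neighbours C A : {set 'I_s} :=
  [set i | [exists e in C, e \subset i |: A]].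

Variable K : fieldType.

Definition sqfree A : {mpoly K[s]} := \prod_(i in A) 'X_i.

Definition edge_ideal C : {mpoly K[s]} -> Prop :=
  ideal_gen (fun g => exists2 e, e \in C & g = sqfree e).

Definition vars_ideal A : {mpoly K[s]} -> Prop :=
  ideal_gen (fun g => exists2 i, i \in A & g = 'X_i).

(* A monomial is given by its exponent vector m; 'X_i divides 'X_[m] exactly
   when U_(i) <= m pointwise. *)
Definition base (m : 'X_{1..s}) : {mpoly K[s]} :=
  \prod_(i < s | (U_(i) <= m)%MM) 'X_i.

End Clutters.

Arguments sqfree {s} K A.
Arguments edge_ideal {s} K C.
Arguments vars_ideal {s} K A.
Arguments base {s} K m.

(* Main.v *)
Require Import Defs.
From mathcomp Require Import all_boot all_algebra.
From mathcomp Require Import mpoly.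

(** The monomial [v] is [t_A] itself, and [p = (I : t_A)] for the following
    reasons.  If [i] is a neighbour of [A], some edge lies in [A] together with
    [i], so its monomial divides ['X_i * t_A]; hence the variables generating
    [p] lie in [(I : t_A)] ([neighbour_in_colon]).  Conversely, an edge is not
    contained in the stable set [A], and by maximality of [A] every vertex
    outside [A] is a neighbour of [A]; so [I] is contained in [p]
    ([edge_ideal_sub_neighbours]).  Thus [f * t_A] in [I] forces [f * t_A] in
    the prime [p], and [t_A] is not in [p]: the neighbours of [A] lie outside
    [A], so the evaluation at the indicator vector of [A] kills [p] and sends
    [t_A] to 1 ([sqfree_notin_neighbours]). *)

Set Implicit Arguments.
Unset Strict Implicit.
Unset Printing Implicit Defensive.

Import GRing.Theory.
Local Open Scope ring_scope.

(** The only real work is closure under addition, where the two families of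
    coefficients and generators are concatenated. *)
Lemma ideal_gen_ideal (R : comNzRingType) (G : R -> Prop) :
  ideal (ideal_gen G).
Proof.
split.
- by exists 0%N, (fun=> 0), (fun=> 0); split=> [[]|] //; rewrite big_ord0.
- move=> _ _ [m [c [g [Gg ->]]]] [n [d [h [Gh ->]]]].
  pose glue (u : 'I_m -> R) (w : 'I_n -> R) (i : 'I_(m + n)) :=
    match split i with inl j => u j | inr k => w k end.
  exists (m + n)%N, (glue c d), (glue g h); split.
    by move=> i; rewrite /glue; case: split.
  have glueL u w j : glue u w (lshift n j) = u j.
    by rewrite /glue (unsplitK (inl _ j)).
  have glueR u w k : glue u w (rshift m k) = w k.
    by rewrite /glue (unsplitK (inr _ k)).
  rewrite big_split_ord /=.
  by congr (_ + _); apply: eq_bigr => i _; rewrite ?glueL ?glueR.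
- move=> f _ [n [c [g [Gg ->]]]].
  exists n, (fun i => f * c i), g; split=> //.
  by rewrite mulr_sumr; apply: eq_bigr => i _; rewrite mulrA.
Qed.

Lemma ideal_gen_mem (R : comNzRingType) (G : R -> Prop) g :
  G g -> ideal_gen G g.
Proof.
by move=> Gg; exists 1%N, (fun=> 1), (fun=> g); rewrite big_ord1 mul1r.
Qed.

Lemma ideal_gen_sub (R : comNzRingType) (G P : R -> Prop) :
  ideal P -> (forall g, G g -> P g) -> forall f, ideal_gen G f -> P f.
Proof.
move=> [P0 PD PM] GP _ [n [c [g [Gg ->]]]].
by apply: big_ind => // i _; apply/PM/GP.
Qed.

Lemma colon_ideal (R : comNzRingType) (I : R -> Prop) v :
  ideal I -> ideal (colon I v).
Proof.
move=> [I0 ID IM]; split; rewrite /colon.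
- by rewrite mul0r.
- by move=> f g If Ig; rewrite mulrDl; apply: ID.
- by move=> f g Ig; rewrite -mulrA; apply: IM.
Qed.

Lemma rmorph_ker_ideal (R R' : comNzRingType) (phi : {rmorphism R -> R'}) :
  ideal (fun f => phi f = 0).
Proof.
split=> [|f g f0 g0|f g g0]; first exact: rmorph0.
- by rewrite rmorphD f0 g0 addr0.
- by rewrite rmorphM g0 mulr0.
Qed.

Lemma sqfree_dvd (K : fieldType) (s : nat) (e B : {set 'I_s}) :
  e \subset B -> sqfree K B = sqfree K (B :\: e) * sqfree K e.
Proof.
by move=> eB; rewrite /sqfree (big_setID e) /= (setIidPr eB) mulrC.
Qed.

Section MaximalStableSets.
Variables (s : nat) (C : {set {set 'I_s}}) (A : {set 'I_s}).

(** Adding to [A] one of its own vertices does not change [A], which contains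
    no edge. *)
Lemma stable_notin_neighbours i :
  stable C A -> i \in neighbours C A -> i \notin A.
Proof.
move=> /forall_inP stA; rewrite inE => /exists_inP[e eC].
by apply: contraTN => iA; rewrite (setUidPr _) ?sub1set // stA.
Qed.

(** By maximality, adding a vertex to [A] creates an edge; so the neighbours
    of a maximal stable set are all the vertices outside it. *)
Lemma maxstable_neighbours i :
  A \in maxstable C -> i \notin A -> i \in neighbours C A.
Proof.
rewrite inE => /maxsetP[_ maxA] iNA; rewrite inE.
have /forall_inPn[e eC /negPn sub] : ~~ stable C (i |: A).
  apply: contra iNA => /maxA/(_ (subsetUr _ _)) <-; exact: setU11.
by apply/exists_inP; exists e.
Qed.

Variable K : fieldType.

(** The edge witnessing that [i] is a neighbour of [A] lies in [i |: A], so its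
    monomial divides ['X_i * t_A]. *)
Lemma neighbour_in_colon i : stable C A -> i \in neighbours C A ->
  colon (edge_ideal K C) (sqfree K A) 'X_i.
Proof.
move=> stA iN; have iNA := stable_notin_neighbours stA iN.
move: iN; rewrite inE => /exists_inP[e eC eiA].
have tiA : 'X_i * sqfree K A = sqfree K (i |: A) by rewrite /sqfree big_setU1.
rewrite /colon tiA (sqfree_dvd K eiA).
have [_ _ mulI] : ideal (edge_ideal K C) by apply: ideal_gen_ideal.
by apply/mulI/ideal_gen_mem; exists e.
Qed.

(** Every edge leaves the stable set [A], at a vertex which is then a neighbour
    of [A]. *)
Lemma edge_ideal_sub_neighbours f : A \in maxstable C ->
  edge_ideal K C f -> vars_ideal K (neighbours C A) f.
Proof.
move=> maxA; apply: ideal_gen_sub; first exact: ideal_gen_ideal.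
move=> _ [e eC ->].
have /forall_inP stA : stable C A.
  by move: maxA; rewrite inE => /maxsetP[].
have /subsetPn[i ie iNA] := stA e eC.
rewrite /sqfree (bigD1 i) //= mulrC.
have [_ _ mulN] : ideal (vars_ideal K (neighbours C A)).
  exact: ideal_gen_ideal.
by apply/mulN/ideal_gen_mem; exists i => //; apply: maxstable_neighbours.
Qed.

(** Evaluation at the point with coordinates 1 on [A] and 0 elsewhere
    separates [t_A] from the ideal of the neighbours. *)
Lemma sqfree_notin_neighbours :
  stable C A -> ~ vars_ideal K (neighbours C A) (sqfree K A).
Proof.
move=> stA.
pose chi (i : 'I_s) : K := (i \in A)%:R.
have kill f : vars_ideal K (neighbours C A) f -> f.@[chi] = 0.
  apply: (ideal_gen_sub (rmorph_ker_ideal (meval chi))) => {f}.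
  move=> _ [i iN ->].
  by rewrite /= mevalXU /chi (negPf (stable_notin_neighbours stA iN)).
move/kill; rewrite /sqfree rmorph_prod /= big1 => [/eqP|i iA].
  by rewrite oner_eq0.
by rewrite mevalXU /chi iA.
Qed.

Definition indicator_mnm : 'X_{1..s} := [multinom (i \in A : nat) | i < s].

Lemma mpolyX_indicator : 'X_[indicator_mnm] = sqfree K A.
Proof.
rewrite mpolyXE_id /sqfree [RHS]big_mkcond /=; apply: eq_bigr => i _.
by rewrite mnmE; case: (i \in A).
Qed.

Lemma base_indicator : base K indicator_mnm = sqfree K A.
Proof.
apply: eq_bigl => i; apply/mnm_lepP/idP => [/(_ i)|iA j].
  by rewrite mnm1E eqxx mnmE; case: (i \in A).
by rewrite mnm1E mnmE; case: eqP => // <-; rewrite iA.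
Qed.

End MaximalStableSets.

Theorem proposition4p3 (K : fieldType) (s : nat) (C : {set {set 'I_s}})
    (hC : clutter C) (p : {mpoly K[s]} -> Prop) (hp : Ass (edge_ideal K C) p)
    (A : {set 'I_s}) (hA : A \in maxstable C)
    (hpA : eq_ideal p (vars_ideal K (neighbours C A))) :
  exists v : 'X_{1..s},
    base K v = sqfree K A /\ eq_ideal p (colon (edge_ideal K C) 'X_[v]).
Proof.
have stA : stable C A by move: hA; rewrite inE => /maxsetP[].
exists (indicator_mnm A); split; first exact: base_indicator.
rewrite mpolyX_indicator => f; split.
- move/hpA; apply: ideal_gen_sub.
    by apply: colon_ideal; apply: ideal_gen_ideal.
  by move=> _ [i iN ->]; apply: neighbour_in_colon.
- have [[_ _ primep] _] := hp.
  move=> /(edge_ideal_sub_neighbours hA)/hpA/primep[//|/hpA tA].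
  by case: (sqfree_notin_neighbours stA tA).
Qed.
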